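(* Let $W$ be the affine Weyl group of type $\widetilde{A}_2$, let $[x,y]$ and $[x',y']$ be Bruhat intervals in $W$, and let $\phi\colon[x,y]\to[x',y']$ be an isomorphism of posets. If $1\le m\le 4$, then $\phi(Z^m_{x,y})=Z^m_{x',y'}$. In particular, $|Z^m_{x,y}|=|Z^m_{x',y'}|$.
   Context: $W$ is the Coxeter group with generators $s_0,s_1,s_2$ and relations $s_i^2=\mathrm{id}$, $(s_is_j)^3=\mathrm{id}$ for $i\ne j$; $\ell$ is the length function, $[x,y]$ denotes an interval in the Bruhat order, and $P_{z,y}(q)$ denotes the Kazhdan-Lusztig polynomial. For a Bruhat interval $[x,y]$ and a positive integer $m$, $$Z^m_{x,y}=\{z\in[x,y] : \ell(y)-\ell(z)=m\text{ and }P_{z,y}(q)=1+q\}.$$ *)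

(* Defs.v *)
From HB Require Import structures.
From Stdlib Require Import Relation_Operators.
From mathcomp Require Import all_boot all_order all_algebra generic_quotient.
From mathcomp Require Import boolp classical_sets functions cardinality fsbigop.

Set Implicit Arguments.
Unset Strict Implicit.
Unset Printing Implicit Defensive.

Import Order.TTheory GRing.Theory.
Local Open Scope quotient_scope.
Local Open Scope classical_set_scope.
Local Open Scope ring_scope.

(** * The Coxeter group given by its presentation *)

Definition word := seq 'I_3.

(* Monoid presentation; since each generator is its own inverse, the quotient
   is the group with the same generators and relations. *)
Inductive cox_congr : word -> word -> Prop :=
  | cox_sq i : cox_congr [:: i; i] [::]
  | cox_braid i j : i != j -> cox_congr [:: i; j; i; j; i; j] [::]
  | cox_refl u : cox_congr u u
  | cox_sym u v : cox_congr u v -> cox_congr v u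
  | cox_trans u v w : cox_congr u v -> cox_congr v w -> cox_congr u w
  | cox_cat u u' v v' :
      cox_congr u u' -> cox_congr v v' -> cox_congr (u ++ v) (u' ++ v').

Definition cox_rel : rel word := fun u v => `[< cox_congr u v >].

Lemma cox_rel_refl : reflexive cox_rel.
Proof. by move=> u; apply/asboolP; apply: cox_refl. Qed.

Lemma cox_rel_sym : symmetric cox_rel.
Proof. by move=> u v; apply/asboolP/asboolP => /cox_sym. Qed.

Lemma cox_rel_trans : transitive cox_rel.
Proof.
by move=> v u w /asboolP uv /asboolP vw; apply/asboolP/(cox_trans uv vw).
Qed.

Canonical cox_equiv := EquivRel cox_rel cox_rel_refl cox_rel_sym cox_rel_trans.

Definition W := {eq_quot cox_equiv}.

HB.instance Definition _ := Choice.on W.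

Definition word_class (u : word) : W := \pi_W u.

Lemma word_classP u v : word_class u = word_class v <-> cox_congr u v.
Proof.
split=> [/eqP|uv]; first by rewrite piE => /asboolP.
by apply/eqP; rewrite piE; apply/asboolP.
Qed.

Lemma repr_word_class u : cox_congr (repr (word_class u)) u.
Proof. by apply/word_classP; rewrite /word_class reprK. Qed.

Lemma word_classK (x : W) : word_class (repr x) = x.
Proof. exact: reprK. Qed.

Lemma cox_rev u v : cox_congr u v -> cox_congr (rev u) (rev v).
Proof.
elim=> {u v} [i|i j ij|u|u v _ /cox_sym //|u v w _ uv _ vw|u u' v v' _ uu _ vv].
- exact: cox_sq.
- by apply: cox_braid; rewrite eq_sym.
- exact: cox_refl.
- exact: cox_trans uv vw.
- by rewrite !rev_cat; apply: cox_cat.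
Qed.

Lemma cox_rev_cat u : cox_congr (rev u ++ u) [::].
Proof.
elim: u => [|i u IHu]; first exact: cox_refl.
rewrite rev_cons -cats1 -catA /=.
apply: cox_trans IHu; apply: cox_cat; first exact: cox_refl.
by rewrite -(cat1s i (i :: u)) -(cat1s i u) catA -[X in cox_congr _ X]cat0s;
  apply: cox_cat; [apply: cox_sq | apply: cox_refl].
Qed.

Definition W_one : W := word_class [::].
Definition W_mul (x y : W) : W := word_class (repr x ++ repr y).
Definition W_inv (x : W) : W := word_class (rev (repr x)).

Lemma W_mul_class u v :
  W_mul (word_class u) (word_class v) = word_class (u ++ v).
Proof. by apply/word_classP/cox_cat; apply: repr_word_class. Qed.

Lemma W_inv_class u : W_inv (word_class u) = word_class (rev u).
Proof. by apply/word_classP/cox_rev/repr_word_class. Qed.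

Lemma W_mulA : associative W_mul.
Proof.
move=> x y z; rewrite -(word_classK x) -(word_classK y) -(word_classK z).
by rewrite !W_mul_class catA.
Qed.

Lemma W_mul1 : left_id W_one W_mul.
Proof. by move=> x; rewrite -(word_classK x) W_mul_class. Qed.

Lemma W_mulr1 : right_id W_one W_mul.
Proof. by move=> x; rewrite -(word_classK x) W_mul_class cats0. Qed.

Lemma W_mulV : left_inverse W_one W_inv W_mul.
Proof.
move=> x; rewrite -(word_classK x) W_inv_class W_mul_class.
by apply/word_classP/cox_rev_cat.
Qed.

Lemma W_mulrV : right_inverse W_one W_inv W_mul.
Proof.
move=> x; rewrite -(word_classK x) W_inv_class W_mul_class.
by apply/word_classP; rewrite -{1}(revK (repr x)); apply: cox_rev_cat.
Qed.

HB.instance Definition _ := isGroup.Build W W_mulA W_mul1 W_mulr1 W_mulV W_mulrV.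

Definition gen (i : 'I_3) : W := word_class [:: i].

(** * Length and Bruhat order *)

Definition has_word (w : W) : pred nat :=
  fun n => `[< exists2 u : word, size u = n & word_class u = w >].

Lemma has_word_ex w : exists n, has_word w n.
Proof.
by exists (size (repr w)); apply/asboolP; exists (repr w); rewrite ?word_classK.
Qed.

Definition ell (w : W) : nat := ex_minn (has_word_ex w).

Definition reflection (t : W) : Prop :=
  exists (w : W) (i : 'I_3), t = (w * gen i * w^-1)%g.

Definition bruhat_step (u v : W) : Prop :=
  (exists2 t, reflection t & v = (u * t)%g) /\ (ell u < ell v)%N.

Definition bruhat_le (u v : W) : bool := `[< clos_refl_trans W bruhat_step u v >].

Lemma bruhat_le_ell u v : bruhat_le u v -> u = v \/ (ell u < ell v)%N.
Proof.
move=> /asboolP; elim=> {u v} [u v [_ ->]|u|u v w _ [->|uv] _ [<-|vw]];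
  by [right | left | right | right; apply: ltn_trans vw].
Qed.

Lemma bruhat_refl : reflexive bruhat_le.
Proof. by move=> u; apply/asboolP/rt_refl. Qed.

Lemma bruhat_anti : antisymmetric bruhat_le.
Proof.
move=> u v /andP[/bruhat_le_ell[//|uv] /bruhat_le_ell[//|vu]].
by have := ltn_trans uv vu; rewrite ltnn.
Qed.

Lemma bruhat_trans : transitive bruhat_le.
Proof.
by move=> v u w /asboolP uv /asboolP vw; apply/asboolP/(rt_trans _ _ _ _ _ uv vw).
Qed.

Fact bruhat_display : Order.disp_t. Proof. exact: Order.Disp tt tt. Qed.

HB.instance Definition _ := @Order.Le_isPOrder.Build bruhat_display W bruhat_le
  bruhat_refl bruhat_anti bruhat_trans.

Definition bruhat_interval (x y : W) : set W := [set z | (x <= z)%O /\ (z <= y)%O].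

(** * Kazhdan-Lusztig polynomials *)

Definition right_descent (v : W) (i : 'I_3) : bool := (ell (v * gen i)%g < ell v)%N.

(* The R-polynomials are the unique family with these properties. *)
Definition R_family (R : W -> W -> {poly int}) : Prop :=
  [/\ forall u v, ~~ (u <= v)%O -> R u v = 0,
      forall u, R u u = 1 &
      forall u v i, right_descent v i ->
        R u v = if right_descent u i then R (u * gen i)%g (v * gen i)%g
                else 'X * R (u * gen i)%g (v * gen i)%g
                     + ('X - 1) * R u (v * gen i)%g].

Definition R_poly : W -> W -> {poly int} := xget (fun _ _ => 0) R_family.

(* q ^ d * p (1 / q), when p has degree at most d *)
Definition poly_reflect (d : nat) (p : {poly int}) : {poly int} :=
  \poly_(i < d.+1) p`_(d - i).

(* The Kazhdan-Lusztig polynomials are the unique family with these properties.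
   The third one says deg P_{u,v} <= (ell v - ell u - 1) / 2.  In the last one
   the sum is over a finite set, as Bruhat intervals are finite. *)
Definition KL_family (P : W -> W -> {poly int}) : Prop :=
  [/\ forall u v, ~~ (u <= v)%O -> P u v = 0,
      forall u, P u u = 1,
      forall u v, (u < v)%O -> ((size (P u v)).-1.*2 < ell v - ell u)%N &
      forall u v, (u <= v)%O ->
        poly_reflect (ell v - ell u) (P u v)
        = \sum_(a \in bruhat_interval u v) R_poly u a * P a v].

Definition KL_poly : W -> W -> {poly int} := xget (fun _ _ => 0) KL_family.

Definition Zset (m : nat) (x y : W) : set W :=
  [set z | [/\ bruhat_interval x y z, (ell z + m)%N = ell y & KL_poly z y = 1 + 'X]].

(* Only the restriction of phi to [x, y] matters. *)
Definition interval_iso (x y x' y' : W) (phi : W -> W) : Prop :=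
  set_bij (bruhat_interval x y) (bruhat_interval x' y') phi /\
  {in bruhat_interval x y &, {mono phi : u v / (u <= v)%O}}.

(* Main.v *)
From Stdlib Require Import ZArith Lia Relation_Operators Operators_Properties.
Require Import Defs.
From mathcomp Require Import all_boot all_order all_algebra.
From mathcomp Require Import boolp classical_sets functions cardinality fsbigop.
From mathcomp Require Import zify.
Import Order.TTheory GRing.Theory Num.Theory.
Local Open Scope classical_set_scope.
Local Open Scope card_scope.

(** Only the cases of length three and four carry content: the degree bound on
Kazhdan-Lusztig polynomials excludes 1 + q in shorter intervals, and in the
cases that remain the polynomial P of an interval of length at most four turns
out to depend on the poset alone ([KL_iso]).  Compare the defining identity of
P in two isomorphic intervals.  By induction on the length all terms of the two
sums agree, except those at the two ends: the first contributes the difference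
D of the two Kazhdan-Lusztig polynomials, the last the difference of the two
R-polynomials.  When the R-polynomials agree, D is its own reflection, which is
absurd for a nonzero D of so low a degree.  In length four the recursion shows
that the R-polynomials differ by a multiple of q (q - 1)^2, and comparing the
coefficients of q and of q^3 gives D = 0 again.

So it is enough to know the R-polynomials of intervals [u, v] of length at most
three.  The recursion gives (q - 1)^l, with an additional q (q - 1) when l = 3
and v = u t for a reflection t ([R_len3]).  What has to be seen is that the
poset [u, v] of length three tells whether v = u t: this happens exactly when
[u, v] has two atoms ([edge_at_most_two], [two_atoms_edge]).

This last fact is plane geometry.  The element w is represented by an alcove of
the triangular lattice, in such a way that multiplying w by a reflection on the
right reflects its alcove in a line, and that ell w counts the lines separating
the alcove from the base alcove.  If v = u t and a = u r is an atom, a saturated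
chain u < a < c < v writes t as a product of three reflections, so that the
lines of r and t and the two others belong to one pencil: they are all parallel
or all pass through a vertex.  Each of the pencils through the line of t takes
a share of the number of lines crossed when going from u to v; three lines are
crossed in all, which leaves room for one such pencil and, in it, for two
choices of r ([up_chain_unique2]).  Conversely, if [u, v] has two atoms, it has
two coatoms lying above both of them; the equations between the reflections
along the chains force all of them into one pencil, and a product of three
reflections in the lines of a pencil is again such a reflection.

The alcove determines the element ([alc_inj]): minimal galleries from the base
alcove to a given alcove spell words that are equal by braid relations.  The
lifting property of the Bruhat order follows from [refl_shift], and saturated
chains and the structure of intervals of length two follow from lifting. *)

(** * Alcoves as integer triples *)

Section Alcoves.
Local Open Scope Z_scope.

Variant dir := D0 | D1 | D2.

(** The plane carries affine coordinates x0 + x1 + x2 = 1 for which the lines of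
the arrangement are x_d = n, with n an integer.  An alcove is encoded by the
integer parts of the three coordinates of its points. *)
Definition alcove := (Z * Z * Z)%type.

(** The reflection in the line x_d = n sends x_d to 2 n - x_d and the other two
coordinates x_e, x_f to 1 - n - x_f, 1 - n - x_e; coordinates of points inside
an alcove are not integers, so the integer part of 1 - n - x is - n minus that
of x. *)
Definition refl (d : dir) (n : Z) (T : alcove) : alcove :=
  let: (a, b, c) := T in
  match d with
  | D0 => (2 * n - 1 - a, - c - n, - b - n)
  | D1 => (- c - n, 2 * n - 1 - b, - a - n)
  | D2 => (- b - n, - a - n, 2 * n - 1 - c)
  end.

(** The number of lines between the alcove and the base alcove (0, 0, 0). *)
Definition dist0 (T : alcove) : Z :=
  let: (a, b, c) := T in Z.abs a + Z.abs b + Z.abs c.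

(** The triples that are integer parts of points of the plane: the fractional
parts sum to 1 or to 2. *)
Definition valid (T : alcove) : Prop :=
  let: (a, b, c) := T in a + b + c = 0 \/ a + b + c = -1.

Definition level (d : dir) (T : alcove) : Z :=
  let: (a, b, c) := T in match d with D0 => a | D1 => b | D2 => c end.

(** The line x_d = n does not separate the alcove from the base alcove, on which
x_d lies between 0 and 1. *)
Definition same_side (d : dir) (n : Z) (T : alcove) : Prop :=
  1 <= n /\ level d T < n \/ n <= 0 /\ n <= level d T.

Lemma tripleP (a b c a' b' c' : Z) :
  (a, b, c) = (a', b', c') <-> [/\ a = a', b = b' & c = c'].
Proof. by split=> [[-> -> ->]|[-> -> ->]]. Qed.

Ltac unfold_alcove := cbv beta iota delta [refl dist0 valid level same_side fst snd].

Lemma refl_valid d n T : valid T -> valid (refl d n T).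
Proof. by case: T => [[a b] c]; case: d; unfold_alcove; lia. Qed.

Lemma reflK d n : involutive (refl d n).
Proof. by case=> [[a b] c]; case: d; unfold_alcove; apply/tripleP; split; lia. Qed.

(** The line x_(image_dir d e) = image_off d e m n is the image of x_e = n under
the reflection in x_d = m. *)
Definition image_dir (d e : dir) : dir :=
  match d, e with
  | D0, D0 => D0 | D1, D1 => D1 | D2, D2 => D2
  | D0, D1 | D1, D0 => D2
  | D0, D2 | D2, D0 => D1
  | D1, D2 | D2, D1 => D0
  end.

Definition image_off (d e : dir) (m n : Z) : Z :=
  match d, e with
  | D0, D0 | D1, D1 | D2, D2 => 2 * m - n
  | _, _ => 1 - m - n
  end.

Lemma refl_conj d e m n T :
  refl d m (refl e n (refl d m T)) = refl (image_dir d e) (image_off d e m n) T.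
Proof.
case: T => [[a b] c].
by case: d; case: e; cbv beta iota delta [refl image_dir image_off];
  apply/tripleP; split; lia.
Qed.

Lemma refl_braid d e T : d <> e ->
  refl e 0 (refl d 0 (refl e 0 (refl d 0 (refl e 0 (refl d 0 T))))) = T.
Proof.
case: T => [[a b] c]; case: d; case: e => // _; unfold_alcove;
  by apply/tripleP; split; lia.
Qed.

Lemma dist0_refl0 d T :
  dist0 (refl d 0 T) = if level d T <? 0 then dist0 T - 1 else dist0 T + 1.
Proof. by case: T => [[a b] c]; case: d; unfold_alcove; case: ifP; lia. Qed.

Lemma level_refl0 d T : (level d (refl d 0 T) < 0) <-> ~ (level d T < 0).
Proof. by case: T => [[a b] c]; case: d; unfold_alcove; lia. Qed.

Lemma level_refl0_neq d e T : d <> e -> valid T ->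
  level d T < 0 -> level e T < 0 ->
  level e (refl d 0 T) < 0 /\ level d (refl e 0 (refl d 0 T)) < 0.
Proof.
by case: T => [[a b] c]; case: d; case: e => // _; unfold_alcove; lia.
Qed.

Lemma dist0_ge0 T : 0 <= dist0 T.
Proof. by case: T => [[a b] c]; unfold_alcove; lia. Qed.

Lemma valid_min T : valid T -> (forall d, ~ level d T < 0) -> T = (0, 0, 0).
Proof.
case: T => [[a b] c] vT nT; move: (nT D0) (nT D1) (nT D2) vT; unfold_alcove.
by move=> *; apply/tripleP; split; lia.
Qed.

(** Lines parallel to the mirror contribute the change of |level d| to the
distance.  The others come in pairs swapped by the reflection, and no such pair
decreases the distance when T is on the same side as the base alcove. *)
Lemma refl_grow d n T : valid T -> same_side d n T ->
  Z.abs (level d T) < Z.abs (level d (refl d n T)) /\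
  Z.abs (level d (refl d n T)) - Z.abs (level d T)
    <= dist0 (refl d n T) - dist0 T.
Proof.
case: T => [[a b] c]; case: d; unfold_alcove => vT;
  by case=> -[H1 H2]; split; lia.
Qed.

Lemma level_reflP d n T : same_side d n (refl d n T) <-> ~ same_side d n T.
Proof. by case: T => [[a b] c]; case: d; unfold_alcove; lia. Qed.

Lemma same_sideP d n T : valid T ->
  (dist0 T < dist0 (refl d n T) <-> same_side d n T).
Proof.
move=> vT; split=> [lt|/(refl_grow d n T vT)]; last by lia.
case: (EM (same_side d n T)) => // /level_reflP.
by move/(refl_grow _ _ _ (refl_valid d n _ vT)); rewrite reflK; lia.
Qed.

(** Reflecting everything in the wall x_e = 0 turns the mirror x_d = n into its
image, and the two mirrors separate the same way from the base alcove, because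
x_e = 0 is the only line between the base alcove and its own reflection. *)
Lemma refl_shift d n e T : valid T -> (d = e -> n <> 0) ->
  dist0 T < dist0 (refl d n T) -> dist0 (refl e 0 T) < dist0 (refl e 0 (refl d n T)).
Proof.
move=> vT ne; have vT' := refl_valid e 0 _ vT.
move/(same_sideP _ _ _ vT) => side.
rewrite -{2}(reflK e 0 T) refl_conj; apply/(same_sideP _ _ _ vT').
move: side ne {vT'}; case: T vT => [[a b] c].
by case: d; case: e; unfold_alcove; rewrite /image_dir /image_off => vT side ne;
  try (have {ne}: n <> 0 by exact: ne); lia.
Qed.

(** * Pencils of lines and chains of reflections *)

Definition line := (dir * Z)%type.

Definition same_dir (d e : dir) : bool :=
  match d, e with D0, D0 | D1, D1 | D2, D2 => true | _, _ => false end.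

(** For p <> q, the line r is parallel to both p and q, or passes through their
common point.  The encoding says that the linear forms of the three lines are
dependent; for three distinct directions this reads n + m + k = 1 because the
coordinates sum to 1. *)
Definition pencil (p q r : line) : Prop :=
  let: ((d, n), (e, m), (f, k)) := (p, q, r) in
  if same_dir d e then if same_dir e f then True else n = m
  else if same_dir f d then k = n
  else if same_dir f e then k = m
  else n + m + k = 1.

Definition line_refl (p : line) (T : alcove) : alcove := refl p.1 p.2 T.

Ltac unfold_pencil :=
  cbv beta iota delta [pencil same_dir line_refl refl image_dir image_off fst snd].

Lemma line_neq (d : dir) (n m : Z) : (d, n) <> (d, m) -> n <> m.
Proof. by move=> ne eq; apply: ne; rewrite eq. Qed.

(** A product of two distinct reflections is a translation or a rotation; it
determines the direction, or the centre, of the pencil of its two mirrors. *)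
Lemma pencil_of_eq p q x y : p <> q ->
  (forall T, line_refl x (line_refl p T) = line_refl y (line_refl q T)) -> pencil p q x.
Proof.
case: p q x y => [d n] [e m] [f k] [g l] ne H.
move: (H (0, 0, 0)) (H (1, 0, 0)) (H (0, 1, 0)) ne => {H}.
case: d; case: e; case: f; case: g; unfold_pencil; rewrite !tripleP;
  move=> [h1 h2 h3] [h4 h5 h6] [h7 h8 h9] ne //; try (move/line_neq: ne => ne);
  lia.
Qed.

Lemma pencil_prod p q x y : p <> q -> pencil p q x -> pencil p q y ->
  exists t, forall T, line_refl y (line_refl x (line_refl p T)) = line_refl t T.
Proof.
case: p q x y => [d n] [e m] [f k] [g l] ne H1 H2.
(* in a vertex group, p x y is the conjugate p x p if p = y, and is x if the
   three lines are distinct *)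
exists (if same_dir d e then (d, l - k + n) else
        if same_dir d f then (g, l) else if same_dir f g then (d, n) else
        if same_dir d g then (image_dir d f, image_off d f n k) else (f, k)).
case=> [[a b] c]; move: ne H1 H2.
by case: d; case: e => ne; try (move/line_neq: ne => ne); case: f; case: g;
  unfold_pencil => H1 H2; apply/tripleP; split; lia.
Qed.

(** Two distinct lines of a pencil span the same pencil. *)
Lemma pencil_trans p q x x' y : p <> q -> x <> x' -> pencil p q x -> pencil p q x' ->
  pencil x x' y -> pencil p q y.
Proof.
case: p q x x' y => [d n] [e m] [f k] [f' k'] [g l] ne ne'.
case: d ne; case: e => ne; try (move/line_neq: ne => ne);
case: f ne'; case: f' => ne'; try (move/line_neq: ne' => ne');
case: g; unfold_pencil; lia.
Qed.

Definition third_line (p q : line) : line :=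
  (image_dir p.1 q.1, image_off p.1 q.1 p.2 q.2).

(** Among the three lines through the common point of t and r, none separates T
from the base alcove, and t is the highest one: its positive root is the sum of
the other two.  Whether n >= 1 or n <= 0 tells the sign with which the form
x_d - n is the positive root of its line; as the three forms sum to 0, the
highest line is the one whose sign differs from that of the others. *)
Definition highest (t r : line) (T : alcove) : Prop :=
  [/\ same_side t.1 t.2 T, same_side r.1 r.2 T,
   same_side (third_line t r).1 (third_line t r).2 T &
   1 <= t.2 /\ r.2 <= 0 /\ (third_line t r).2 <= 0 \/
   t.2 <= 0 /\ 1 <= r.2 /\ 1 <= (third_line t r).2].

Ltac unfold_highest := rewrite /highest /third_line;
  cbv beta iota delta [same_dir image_dir image_off refl dist0 valid level
    same_side fst snd].

(** Reflecting in the highest line of a vertex also crosses the other two lines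
through that vertex, which are not parallel to it. *)
Lemma highest_grow (t r : line) (T : alcove) : valid T ->
  ~~ same_dir t.1 r.1 -> highest t r T ->
  Z.abs (level t.1 (line_refl t T)) - Z.abs (level t.1 T) + 2 <=
  dist0 (line_refl t T) - dist0 T.
Proof.
case: t r T => [d m] [e p] [[a b] c]; rewrite /line_refl.
by case: d; case: e => vT // _; move: vT; unfold_highest => vT [H1 H2 H3 [H4|H4]]; lia.
Qed.

(** Two vertices on the line t each contribute their two other lines. *)
Lemma highest2_grow (t r r' : line) (T : alcove) : valid T ->
  ~~ same_dir t.1 r.1 -> ~~ same_dir t.1 r'.1 -> highest t r T -> highest t r' T ->
  r' <> r -> r' <> third_line t r ->
  Z.abs (level t.1 (line_refl t T)) - Z.abs (level t.1 T) + 4 <=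
  dist0 (line_refl t T) - dist0 T.
Proof.
case: t r r' T => [d m] [e p] [f q] [[a b] c]; rewrite /line_refl.
case: d; case: e => vT //; case: f => // _ _; move: vT;
  unfold_highest => vT -[H1 H2 H3 H4] [_ H5 H6 H7];
  try (move/line_neq => H8 _) ; try (move=> _ /line_neq H8);
  case: H4 => H4; case: H7 => H7; lia.
Qed.

Lemma line_refl_valid p T : valid T -> valid (line_refl p T).
Proof. exact: refl_valid. Qed.

Lemma line_reflK p : involutive (line_refl p).
Proof. exact: reflK. Qed.

Lemma line_refl_up p T : valid T ->
  dist0 T < dist0 (line_refl p T) -> same_side p.1 p.2 T.
Proof. by move=> vT /same_sideP; apply. Qed.

Lemma same_dirP d e : reflect (d = e) (same_dir d e).
Proof. by case: d; case: e; constructor. Qed.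

(** The alcoves T, T r, T r x, T r x y = T t of a saturated chain whose ends are
joined by a reflection t. *)
Definition up_chain (t r x y : line) (T : alcove) : Prop :=
  [/\ forall S, line_refl y (line_refl x (line_refl r S)) = line_refl t S,
   dist0 (line_refl r T) = dist0 T + 1,
   dist0 (line_refl x (line_refl r T)) = dist0 T + 2 &
   dist0 (line_refl t T) = dist0 T + 3].

Lemma up_chain_pencil t r x y T : up_chain t r x y T ->
  pencil r t x /\ pencil t r y.
Proof.
case=> eqt dr dx dt.
have ne : r <> t by move=> eq; move: dt; rewrite -eq; lia.
split.
  by apply: (@pencil_of_eq _ _ _ y) => // S; rewrite -eqt line_reflK.
apply: (@pencil_of_eq _ _ _ x) => [/esym //|S].
by rewrite -eqt line_reflK.
Qed.

(** In the parallel case the distance to the base alcove in the direction of t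
grows at each of the three steps, and by at least three in all; by [refl_grow]
the first step then moves to one of the two levels next to that of T. *)
Lemma up_chain_parallel t r x y T : valid T -> up_chain t r x y T -> r.1 = t.1 ->
  Z.abs (level t.1 (line_refl r T)) = Z.abs (level t.1 T) + 1 /\
  Z.abs (level t.1 T) + 3 <= Z.abs (level t.1 (line_refl t T)).
Proof.
move=> vT ch rt; have [px py] := up_chain_pencil _ _ _ _ _ ch.
case: ch => eqt dr dx dt.
have ne : r <> t by move=> eq; move: dt; rewrite -eq; lia.
have xt : x.1 = t.1.
  case: r x t rt ne px {eqt dr dx dt py} => [d n] [e m] [f k] /= <-.
  by case: d; case: e => // /line_neq /= ne; unfold_pencil.
have yt : y.1 = t.1.
  case: r y t rt ne py {eqt dr dx dt px xt} => [d n] [e m] [f k] /= <-.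
  by case: d; case: e => // /line_neq /= ne; unfold_pencil => eq; case: ne.
have vr := line_refl_valid r _ vT; have vx := line_refl_valid x _ vr.
have [h1 h2] := refl_grow r.1 r.2 T vT (line_refl_up r T vT ltac:(lia)).
have [h3 h4] := refl_grow x.1 x.2 _ vr (line_refl_up x _ vr ltac:(lia)).
have := refl_grow y.1 y.2 _ vx (line_refl_up y _ vx ltac:(rewrite eqt; lia)).
rewrite -[refl y.1 _ _]/(line_refl y _) eqt yt => -[h5 h6].
move: h1 h2 h3 h4; rewrite -!/(line_refl _ _) xt rt; lia.
Qed.

(** In the vertex case the six alcoves obtained from T by reflections in the three
lines are ordered like the symmetric group, and a chain of length three joins
its least to its greatest element. *)
Lemma up_chain_highest t r x y T : valid T -> up_chain t r x y T -> r.1 <> t.1 ->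
  highest t r T.
Proof.
move=> vT ch rt; have [px py] := up_chain_pencil _ _ _ _ _ ch.
case: ch => eqt dr dx dt.
have vr := line_refl_valid r _ vT; have vx := line_refl_valid x _ vr.
move: (line_refl_up r T vT ltac:(lia)) (line_refl_up x _ vr ltac:(lia)).
move: (line_refl_up y _ vx ltac:(rewrite eqt; lia)) (line_refl_up t T vT ltac:(lia)).
have eqT := eqt T.
move: {eqt dr dx dt vr vx} rt px py eqT.
case: t r x y T vT => [d n] [e m] [f k] [g l] [[a b] c].
case: d; case: e => //; case: f; case: g => // vT _;
  unfold_highest; unfold_pencil; cbv beta iota delta [valid] in vT.
all: by rewrite !tripleP => px py [e1 e2 e3] s1 s2 s3 s4; split; lia.
Qed.

(** The distance grows by three, which by [highest_grow], [highest2_grow] and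
[up_chain_parallel] is too little for two different pencils; one pencil offers
two first steps. *)
Lemma up_chain_unique2 t r1 x1 y1 r2 x2 y2 r3 x3 y3 T : valid T ->
  up_chain t r1 x1 y1 T -> up_chain t r2 x2 y2 T -> up_chain t r3 x3 y3 T ->
  [\/ r1 = r2, r2 = r3 | r1 = r3].
Proof.
move=> vT c1 c2 c3.
have dt : dist0 (line_refl t T) = dist0 T + 3 by case: c1.
have no_mix r x y r' x' y' : up_chain t r x y T -> up_chain t r' x' y' T ->
    r.1 = t.1 -> r'.1 = t.1.
  move=> c c' rt; have [//|r't] := EM (r'.1 = t.1).
  have [_ h] := up_chain_parallel _ _ _ _ _ vT c rt.
  have /same_dirP nd : t.1 <> r'.1 by move/esym.
  have := highest_grow _ _ _ vT nd (up_chain_highest _ _ _ _ _ vT c' r't).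
  lia.
have [rt1|nrt1] := EM (r1.1 = t.1).
  have rt2 := no_mix _ _ _ _ _ _ c1 c2 rt1.
  have rt3 := no_mix _ _ _ _ _ _ c1 c3 rt1.
  have [h1 _] := up_chain_parallel _ _ _ _ _ vT c1 rt1.
  have [h2 _] := up_chain_parallel _ _ _ _ _ vT c2 rt2.
  have [h3 _] := up_chain_parallel _ _ _ _ _ vT c3 rt3.
  case: r1 r2 r3 t rt1 rt2 rt3 h1 h2 h3 {c1 c2 c3 dt no_mix}
    => [d1 n1] [d2 n2] [d3 n3] [d n] /= -> -> ->.
  case: T {vT} => [[a b] c] h1 h2 h3.
  suff : n1 = n2 \/ n2 = n3 \/ n1 = n3.
    by case=> [->|[->|->]]; [apply: Or31|apply: Or32|apply: Or33].
  move: h1 h2 h3; case: d; unfold_pencil; cbv beta iota delta [level]; lia.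
have nrt r x y : up_chain t r x y T -> ~~ same_dir t.1 r.1.
  by move=> c; apply/same_dirP => /esym rt; apply: nrt1; apply: no_mix c c1 rt.
have high r x y : up_chain t r x y T -> highest t r T.
  move=> c; apply: (up_chain_highest _ _ _ _ _ vT c) => rt.
  by apply: nrt1; apply: no_mix c c1 rt.
have two r x y : up_chain t r x y T -> r = r1 \/ r = third_line t r1.
  move=> c; have [|ne] := EM (r = r1); first by left.
  have [|ne'] := EM (r = third_line t r1); first by right.
  have := highest2_grow _ _ _ _ vT (nrt _ _ _ c1) (nrt _ _ _ c)
    (high _ _ _ c1) (high _ _ _ c) ne ne'.
  have := refl_grow t.1 t.2 T vT (line_refl_up t T vT ltac:(lia)).
  rewrite -!/(line_refl _ _); lia.
have [->|->] := two _ _ _ c2; first by apply: Or31.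
by have [->|->] := two _ _ _ c3; [apply: Or33 | apply: Or32].
Qed.

End Alcoves.

(** * Elements of the group as alcoves *)

Section Action.
Local Open Scope Z_scope.

Definition axis (i : 'I_3) : dir :=
  match val i with 0%N => D0 | 1%N => D1 | _ => D2 end.

Lemma axis_inj : injective axis.
Proof.
by case=> [[|[|[|i]]] hi] // [[|[|[|j]]] hj] // _; apply/val_inj.
Qed.

Lemma axis_surj d : exists i, axis i = d.
Proof.
by case: d; [exists (inord 0)|exists (inord 1)|exists (inord 2)];
  rewrite /axis /= inordK.
Qed.

(** Letters act from left to right, so this is a right action: appending a letter
to the word reflects the alcove in one of the three walls of the base alcove. *)
Definition act_word (u : word) (T : alcove) : alcove :=
  foldl (fun S i => refl (axis i) 0 S) T u.

Lemma act_word_cat u v T : act_word (u ++ v) T = act_word v (act_word u T).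
Proof. exact: foldl_cat. Qed.

Lemma act_congr u v : cox_congr u v -> forall T, act_word u T = act_word v T.
Proof.
elim=> {u v} [i|i j ij|u|u v _ IH|u v w _ IH1 _ IH2|u u' v v' _ IH1 _ IH2] T //.
- exact: reflK.
- by apply: refl_braid => /axis_inj eq; rewrite eq eqxx in ij.
- by rewrite IH1.
- by rewrite !act_word_cat IH1 IH2.
Qed.

Definition act (w : W) (T : alcove) : alcove := act_word (repr w) T.

Lemma act_class u T : act (word_class u) T = act_word u T.
Proof. exact/act_congr/repr_word_class. Qed.

Lemma act1 T : act 1%g T = T.
Proof. exact: act_class. Qed.

Lemma actM x y T : act (x * y)%g T = act y (act x T).
Proof. by rewrite [LHS]act_class act_word_cat. Qed.

Lemma act_gen i T : act (gen i) T = refl (axis i) 0 T.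
Proof. exact: act_class. Qed.

Lemma mul_class u v : (word_class u * word_class v)%g = word_class (u ++ v).
Proof. exact: W_mul_class. Qed.

Lemma gen2 i : (gen i * gen i = 1)%g.
Proof.
by rewrite /gen mul_class; apply/word_classP/cox_sq.
Qed.

Lemma genK i : (gen i)^-1%g = gen i.
Proof. by apply: mulg1_eq; apply: gen2. Qed.

Lemma mulgenK i (x : W) : (x * gen i * gen i = x)%g.
Proof. by rewrite -mulgA gen2 mulg1. Qed.

Lemma gen_braid i j : i <> j ->
  (gen i * gen j * gen i = gen j * gen i * gen j)%g.
Proof.
move=> ij.
have : (gen i * gen j * gen i * gen j * gen i * gen j = 1)%g.
  by rewrite /gen !mul_class; apply/word_classP/cox_braid/eqP.
by move/(congr1 (fun w => w * gen j * gen i * gen j)%g); rewrite !mulgenK mul1g.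
Qed.

Lemma act_valid w T : valid T -> valid (act w T).
Proof.
rewrite /act; elim: (repr w) T => //= i u IH T vT.
exact/IH/refl_valid.
Qed.

Definition alc (w : W) : alcove := act w (0, 0, 0).

Lemma alc_valid w : valid (alc w).
Proof. by apply: act_valid; left. Qed.

Lemma alc1 : alc 1%g = (0, 0, 0).
Proof. exact: act1. Qed.

Lemma alcM x y : alc (x * y)%g = act y (alc x).
Proof. exact: actM. Qed.

Lemma alc_gen x i : alc (x * gen i)%g = refl (axis i) 0 (alc x).
Proof. by rewrite alcM act_gen. Qed.

(** The element spelled by some path from the base alcove to T that moves away
from the base alcove at each step. *)
Inductive gallery : alcove -> W -> Prop :=
  | gallery1 : gallery (0, 0, 0) 1%g
  | galleryS T w i : gallery T w -> ~ level (axis i) T < 0 ->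
      gallery (refl (axis i) 0 T) (w * gen i)%g.

Lemma gallery_alc T w : gallery T w -> alc w = T.
Proof.
by elim=> {T w} [|T w i _ IH _]; rewrite ?alc1 // alc_gen IH.
Qed.

(** The last step of a gallery may be taken in any descent direction i of T: if
the given last letter is j <> i, then T is at the far end of its coset under
the dihedral group of i and j, and the braid relation exchanges the last three
letters. *)
Lemma gallery_last T w i : valid T -> gallery T w -> level (axis i) T < 0 ->
  exists2 v, gallery (refl (axis i) 0 T) v & w = (v * gen i)%g.
Proof.
have [n] : exists n : nat, dist0 T < Z.of_nat n.
  by exists (Z.to_nat (dist0 T + 1)); have := dist0_ge0 T; lia.
elim: n T w i => [|n IH] T w i lt vT; first by have := dist0_ge0 T; lia.
move=> gw; case: gw lt vT i => {T w} [|T w j gw posj] lt vT' i.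
  by case: (axis i) => /=; lia.
have vT : valid T by rewrite -(reflK (axis j) 0 T); apply: refl_valid.
have [<- _|ji negi] := EM (j = i); first by exists w; rewrite ?reflK.
have ltT : dist0 T < Z.of_nat n.
  have := dist0_refl0 (axis j) T; case: Z.ltb_spec; lia.
have negj : level (axis j) (refl (axis j) 0 T) < 0 by apply/level_refl0.
have axji : axis j <> axis i by move/axis_inj.
have [] := level_refl0_neq _ _ _ axji vT' negj negi.
have [] := level_refl0_neq _ _ _ (nesym axji) vT' negi negj.
set T' := refl (axis j) 0 T in lt vT' negi negj *.
rewrite reflK => negj1 negi2 negi1 negj2.
have [v1 gv1 wv1] := IH _ _ _ ltT vT gw negi1.
have ltT1 : dist0 (refl (axis i) 0 T) < Z.of_nat n.
  by have := dist0_refl0 (axis i) T; case: Z.ltb_spec; lia.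
have [v2 gv2 v12] := IH _ _ _ ltT1 (refl_valid _ _ _ vT) gv1 negj2.
exists (v2 * gen i * gen j)%g; last first.
  rewrite wv1 v12 -!(mulgA v2) -!(mulgA _ (gen i)) -!(mulgA _ (gen j)).
  by congr (_ * _)%g; rewrite !mulgA (gen_braid j i).
have [neg1 neg2] := level_refl0_neq _ _ _ (nesym axji) vT' negi negj.
have pos2 : ~ level (axis j) (refl (axis j) 0 (refl (axis i) 0 T')) < 0.
  by move/level_refl0; apply.
have br : refl (axis j) 0 (refl (axis i) 0 T') =
    refl (axis i) 0 (refl (axis j) 0 (refl (axis i) 0 T)).
  have := refl_braid _ _ T (nesym axji).
  move/(congr1 (refl (axis j) 0)); rewrite reflK.
  move/(congr1 (refl (axis i) 0)); rewrite reflK.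
  by move/(congr1 (refl (axis j) 0)); rewrite reflK.
rewrite -(reflK (axis j) 0 (refl (axis i) 0 T')) br.
apply: galleryS; last by move: pos2; rewrite br.
by apply: galleryS => //; move: neg2; rewrite br => /level_refl0.
Qed.

Lemma gallery_uniq T v w : gallery T v -> gallery T w -> v = w.
Proof.
move=> gv; elim: gv w => {T v} [|T v i gv IH pos] w gw.
  move def : (0, 0, 0) gw => T gw; case: gw def => // {w} {}T w i gw pos.
  move=> def; have vT : valid T by rewrite -(gallery_alc _ _ gw); apply: alc_valid.
  by move/level_refl0: pos; rewrite -def; case: (axis i) => /=; lia.
have vT : valid T by rewrite -(gallery_alc _ _ gv); apply: alc_valid.
have neg : level (axis i) (refl (axis i) 0 T) < 0 by apply/level_refl0.
have [u] := gallery_last _ _ _ (refl_valid _ _ _ vT) gw neg.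
by rewrite reflK => /IH <- ->.
Qed.

(** Reading a word letter by letter: an ascent extends the gallery, a descent
deletes the last letter of a suitable gallery by [gallery_last]. *)
Lemma galleryP w : gallery (alc w) w.
Proof.
rewrite -(word_classK w); elim/last_ind: (repr w) => [|u i IH].
  by rewrite [alc _]alc1; exact: gallery1.
rewrite -cats1 -mul_class -/(gen i) alc_gen.
have [neg|pos] := EM (level (axis i) (alc (word_class u)) < 0); last first.
  exact: galleryS IH pos.
have [v gv uv] := gallery_last _ _ _ (alc_valid _) IH neg.
by rewrite {2}uv mulgenK.
Qed.

Lemma alc_inj : injective alc.
Proof.
by move=> v w eq; apply: gallery_uniq (galleryP v) _; rewrite eq; apply: galleryP.
Qed.

Lemma dist0_word u : dist0 (alc (word_class u)) <= Z.of_nat (size u).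
Proof.
elim/last_ind: u => [|u i IH]; first by rewrite [alc _]alc1.
rewrite -cats1 -mul_class -/(gen i) alc_gen size_cat /=.
by have := dist0_refl0 (axis i) (alc (word_class u)); case: Z.ltb_spec; lia.
Qed.

Lemma gallery_word T w : gallery T w ->
  exists2 u, Z.of_nat (size u) = dist0 T & word_class u = w.
Proof.
elim=> {T w} [|T w i _ [u su <-] pos]; first by exists [::].
exists (rcons u i); last by rewrite -cats1 -mul_class.
rewrite size_rcons; have := dist0_refl0 (axis i) T.
by case: Z.ltb_spec; lia.
Qed.

Lemma ell_dist0 w : Z.of_nat (ell w) = dist0 (alc w).
Proof.
rewrite /ell; case: ex_minnP => n /asboolP [u <- uw] min_n.
have [v sv vw] := gallery_word _ _ (galleryP w).
have := dist0_word u; rewrite uw.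
have := min_n (size v); have -> : has_word w (size v) by apply/asboolP; exists v.
by move=> /(_ isT); lia.
Qed.

Lemma right_descentE w i : right_descent w i <-> level (axis i) (alc w) < 0.
Proof.
rewrite /right_descent.
have := ell_dist0 w; have := ell_dist0 (w * gen i)%g; rewrite alc_gen dist0_refl0.
by case: Z.ltb_spec; lia.
Qed.

Lemma ell_gen w i :
  ell (w * gen i)%g = if right_descent w i then (ell w).-1 else (ell w).+1.
Proof.
have := ell_dist0 w; have := ell_dist0 (w * gen i)%g; rewrite alc_gen dist0_refl0.
by rewrite /right_descent; case: Z.ltb_spec; case: ifP; lia.
Qed.

Lemma ell_down w i : right_descent w i -> ell w = (ell (w * gen i)%g).+1.
Proof. by have := ell_gen w i; rewrite /right_descent; case: ifP; lia. Qed.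

Lemma ell_up w i : ~~ right_descent w i -> ell (w * gen i)%g = (ell w).+1.
Proof. by rewrite ell_gen => /negbTE ->. Qed.

Definition acts_as (t : W) (p : line) : Prop := forall T, act t T = line_refl p T.

Lemma acts_as_conj t p j : acts_as t p ->
  acts_as (gen j * t * gen j)%g
    (image_dir (axis j) p.1, image_off (axis j) p.1 0 p.2).
Proof. by move=> tp T; rewrite !actM !act_gen tp refl_conj. Qed.

Lemma reflection_conj t j : reflection t -> reflection (gen j * t * gen j)%g.
Proof.
by case=> w [i ->]; exists (gen j * w)%g, i; rewrite invgM genK !mulgA.
Qed.

Lemma reflection_acts t : reflection t -> exists p, acts_as t p.
Proof.
case=> w [i ->]; rewrite -(word_classK w); elim: (repr w) => [|j u [p pP]].
  exists (axis i, 0) => T.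
  by rewrite -[word_class [::]]/(1%g : W) invg1 mulg1 mul1g act_gen.
have -> : word_class (j :: u) = (gen j * word_class u)%g by rewrite mul_class.
have := acts_as_conj _ _ j pP; rewrite invgM genK !mulgA.
by move=> ?; eexists; eassumption.
Qed.

(** Every line of the arrangement is the mirror of a reflection of the group:
conjugation by a wall of another direction lowers the offset n > 0 to 1 - n. *)
Lemma acts_reflection p : exists2 t, reflection t & acts_as t p.
Proof.
case: p => d n.
have [k] : exists k : nat, Z.abs n <= Z.of_nat k by exists (Z.to_nat (Z.abs n)); lia.
elim: k d n => [|k IH] d n le.
  have [i id] := axis_surj d; exists (gen i).
    by exists 1%g, i; rewrite invg1 mulg1 mul1g.
  by move=> T; rewrite act_gen id; have -> : n = 0 by lia.
have pos m e : 0 < m <= Z.of_nat k.+1 -> exists2 t, reflection t & acts_as t (e, m).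
  move=> mP.
  have [f [ef fe]] : exists f, image_dir f (image_dir f e) = e /\ f <> e.
    by case: e {mP}; [exists D1|exists D2|exists D0].
  have [j jf] := axis_surj f.
  have [|t rt tP] := IH (image_dir f e) (1 - m); first by lia.
  exists (gen j * t * gen j)%g; first exact: reflection_conj.
  have := acts_as_conj _ _ j tP; rewrite jf /= ef.
  suff -> : image_off f (image_dir f e) 0 (1 - m) = m by [].
  by case: f fe {jf ef tP}; case: e => // _ ; rewrite /image_dir /image_off; lia.
have [npos|nneg] := Z_lt_le_dec 0 n; first by apply: pos; lia.
have [n0|n0] := Z.eq_dec n 0; first by apply: IH; lia.
have [|t rt tP] := pos (- n) d; first by lia.
have [j jd] := axis_surj d.
exists (gen j * t * gen j)%g; first exact: reflection_conj.
have := acts_as_conj _ _ j tP; rewrite jd /=.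
suff [-> ->] : image_dir d d = d /\ image_off d d 0 (- n) = n by [].
by split; case: d {pos tP jd}; rewrite /image_off //; lia.
Qed.

Lemma acts_as_alc t p u : acts_as t p -> alc (u * t)%g = line_refl p (alc u).
Proof. by move=> tp; rewrite alcM tp. Qed.

End Action.

Definition edge (u v : W) : Prop := exists2 t, reflection t & v = (u * t)%g.

Lemma edgeP u v : edge u v <-> exists p, alc v = line_refl p (alc u).
Proof.
split=> [[t /reflection_acts [p tp] ->]|[p vp]].
  by exists p; apply: acts_as_alc.
have [t rt tp] := acts_reflection p; exists t => //.
by apply: alc_inj; rewrite vp (acts_as_alc _ _ _ tp).
Qed.

(** * The Bruhat order *)

Local Open Scope group_scope.

Lemma ell_lt (u v : W) : (ell u < ell v)%N <-> Z.lt (dist0 (alc u)) (dist0 (alc v)).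
Proof. by rewrite -!ell_dist0; lia. Qed.

Lemma bruhat_step_shift (u v : W) i : bruhat_step u v ->
  v = (u * gen i)%g \/ bruhat_step (u * gen i)%g (v * gen i)%g.
Proof.
case=> -[t rt vt] lt.
have [|ne] := EM (v = (u * gen i)%g); [by left|right; split].
  exists (gen i * t * gen i)%g; first exact: reflection_conj.
  by rewrite vt !mulgA mulgenK.
have [p tp] := reflection_acts _ rt.
have vp := acts_as_alc _ _ u tp; rewrite -vt in vp.
apply/ell_lt; rewrite !alc_gen vp; apply: refl_shift; first exact: alc_valid.
  move=> pi p0; apply: ne; apply: alc_inj; rewrite vp alc_gen /line_refl pi p0 //.
by move/ell_lt: lt; rewrite vp.
Qed.

Lemma bruhatP (u v : W) : (u <= v)%O <-> clos_refl_trans W bruhat_step u v.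
Proof. by rewrite -[(u <= v)%O]/(bruhat_le u v); split=> /asboolP. Qed.

Lemma step_le (u v : W) : bruhat_step u v -> (u <= v)%O.
Proof. by move=> uv; apply/bruhatP/rt_step. Qed.

Lemma gen_step (u : W) i : ~~ right_descent u i -> bruhat_step u (u * gen i)%g.
Proof.
move=> up; split; last by rewrite ell_gen (negbTE up).
by exists (gen i) => //; exists 1%g, i; rewrite invg1 mulg1 mul1g.
Qed.

Lemma right_descent_gen (u : W) i : right_descent (u * gen i)%g i = ~~ right_descent u i.
Proof.
rewrite {1}/right_descent mulgenK ell_gen.
by case: ifP; rewrite /right_descent; lia.
Qed.

Lemma le_gen (u : W) i : ~~ right_descent u i -> (u <= u * gen i)%O.
Proof. by move/gen_step/step_le. Qed.

Lemma gen_le (u : W) i : right_descent u i -> (u * gen i <= u)%O.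
Proof.
by move=> d; rewrite -{2}(mulgenK i u); apply: le_gen; rewrite right_descent_gen negbK.
Qed.

Lemma bruhat_ell (u v : W) : (u <= v)%O -> u = v \/ (ell u < ell v)%N.
Proof. exact: bruhat_le_ell. Qed.

Lemma bruhat_eq (u v : W) : (u <= v)%O -> (ell v <= ell u)%N -> u = v.
Proof. by case/bruhat_ell => //; lia. Qed.

Lemma bruhat_leE (u v : W) : (u <= v)%O -> (ell u <= ell v)%N.
Proof. by case/bruhat_ell => [->//|]; lia. Qed.

(** Lifting without hypotheses on descents, along a chain by
[bruhat_step_shift]; the usual forms of the lifting property follow. *)
Lemma shift_left (u v : W) i : (u <= v)%O ->
  (u * gen i <= v)%O \/ (u * gen i <= v * gen i)%O.
Proof.
move/bruhatP/clos_rt_rt1n_iff; elim=> {u v} [u|u w v uw wv IH]; first by right.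
have {}wv : (w <= v)%O by apply/bruhatP/clos_rt_rt1n_iff.
have [<-|/step_le uw'] := bruhat_step_shift _ _ i uw; first by left.
by case: IH => h; [left|right]; apply: le_trans h.
Qed.

Lemma shift_right (u v : W) i : (u <= v)%O ->
  (u <= v * gen i)%O \/ (u * gen i <= v * gen i)%O.
Proof.
move/bruhatP/clos_rt_rtn1_iff; elim=> {v} [|w v wv uw IH]; first by right.
have {}uw : (u <= w)%O by apply/bruhatP/clos_rt_rtn1_iff.
have [->|/step_le wv'] := bruhat_step_shift _ _ i wv.
  by rewrite mulgenK; left.
by case: IH => h; [left|right]; apply: le_trans wv'.
Qed.

Lemma lift_down (u v : W) i : (u <= v)%O -> right_descent v i -> ~~ right_descent u i ->
  (u <= v * gen i)%O.
Proof.
move=> uv dv du; case: (shift_right _ _ i uv) => // h.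
exact: le_trans (le_gen _ _ du) h.
Qed.

Lemma lift_up (u v : W) i : (u <= v)%O -> right_descent v i -> (u * gen i <= v)%O.
Proof.
move=> uv dv; case: (shift_left _ _ i uv) => // h.
exact: le_trans h (gen_le _ _ dv).
Qed.

Lemma lift_both (u v : W) i : (u <= v)%O -> right_descent u i = right_descent v i ->
  (u * gen i <= v * gen i)%O.
Proof.
move=> uv duv; have [dv|nv] := boolP (right_descent v i).
  case: (shift_right _ _ i uv) => // h.
  by apply: le_trans h; apply: gen_le; rewrite duv.
case: (shift_left _ _ i uv) => // h; exact: le_trans h (le_gen _ _ nv).
Qed.

Lemma exists_descent (v : W) : (0 < ell v)%N -> exists i, right_descent v i.
Proof.
move=> v0; have [[d neg]|nneg] := EM (exists d, Z.lt (level d (alc v)) 0).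
  have [i id] := axis_surj d; exists i; apply/right_descentE; by rewrite id.
have := ell_dist0 v; rewrite (valid_min _ (alc_valid v)) /=; first by lia.
by move=> d neg; apply: nneg; exists d.
Qed.

(** Induction on ell v with a right descent i of v: when i is also a descent of u,
a coatom of [u s, v s] is moved up by s, unless s already lowers it, and then u
lies below v s. *)
Lemma coatom_ex (u v : W) : (u < v)%O ->
  exists a, [/\ (u <= a)%O, (a <= v)%O & ell v = (ell a).+1].
Proof.
have [n] := ubnP (ell v); elim: n u v => // n IH u v ltn uv.
have le_uv := ltW uv.
have euv : (ell u < ell v)%N.
  by case: (bruhat_ell _ _ (ltW uv)) => // eq; rewrite eq ltxx in uv.
have [i dv] : exists i, right_descent v i by apply: exists_descent; lia.
have ev := ell_down _ _ dv.
have vsv := gen_le _ _ dv.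
have [du|nu] := boolP (right_descent u i); last first.
  by exists (v * gen i); split; [apply: lift_down|exact: vsv|].
have eu := ell_down _ _ du.
have := lift_both _ _ i (ltW uv); rewrite du dv => /(_ erefl) le'.
have lt' : (u * gen i < v * gen i)%O.
  rewrite lt_neqAle le' andbT; apply/eqP => /mulIg eq; by rewrite eq ltxx in uv.
have nu' : ~~ right_descent (u * gen i) i by rewrite right_descent_gen du.
have nv' : ~~ right_descent (v * gen i) i by rewrite right_descent_gen dv.
have [|a [ua av ea]] := IH _ _ _ lt'; first by lia.
have [da|na] := boolP (right_descent a i).
  exists (v * gen i); split; [|exact: vsv|exact: ev].
  by apply: le_trans av; rewrite -(mulgenK i u); apply: lift_up.
have ea' := ell_up _ _ na.
exists (a * gen i); split; [| |by rewrite ev ea ea'].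
  by rewrite -(mulgenK i u); apply: lift_both => //; rewrite (negbTE na) (negbTE nu').
by rewrite -(mulgenK i v); apply: lift_both => //; rewrite (negbTE na) (negbTE nv').
Qed.

(** * Intervals of length two and three *)

Definition atom (u v a : W) : Prop :=
  [/\ (u <= a)%O, (a <= v)%O & ell a = (ell u).+1].

Lemma atom_ex (u v : W) : (u < v)%O -> exists a, atom u v a.
Proof.
have [n] := ubnP (ell v); elim: n v => // n IH v ltn uv.
have [a [ua av ea]] := coatom_ex _ _ uv.
have [eq|/eqP ne] := EM (u = a); first by exists v; split; rewrite ?(ltW uv) // eq.
have [||b [ub ba eb]] := IH a; first by lia.
  by rewrite lt_neqAle ne.
by exists b; split=> //; apply: le_trans av.
Qed.

Lemma cover_edge (u v : W) : (u <= v)%O -> ell v = (ell u).+1 -> edge u v.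
Proof.
move/bruhatP/clos_rt_rt1n_iff => uv; case: uv => [|w v' [uw ltw] wv ev]; first by lia.
have {}wv : (w <= v')%O by apply/bruhatP/clos_rt_rt1n_iff.
by rewrite -(bruhat_eq _ _ wv) //; lia.
Qed.

Lemma edge_le (u v : W) : edge u v -> (ell u < ell v)%N -> (u <= v)%O.
Proof. by move=> uv lt; apply: step_le; split. Qed.

(** A descent i of v that is not one of u gives the two atoms u s and v s.
Otherwise the two atoms of [u s, v s] are moved up by s; if one of them is u,
it is replaced by v s. *)
Lemma diamond (u v : W) : (u <= v)%O -> ell v = (ell u).+2 ->
  exists a b, [/\ a <> b, atom u v a, atom u v b &
    forall c, atom u v c -> c = a \/ c = b].
Proof.
have [n] := ubnP (ell v); elim: n u v => // n IH u v ltn uv euv.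
have [i dv] : exists i, right_descent v i by apply: exists_descent; lia.
have ev := ell_down _ _ dv.
have vsv := gen_le _ _ dv.
have nv' : ~~ right_descent (v * gen i) i by rewrite right_descent_gen dv.
have up_atom c : atom u v c -> ~~ right_descent c i -> c = v * gen i.
  case=> uc cv ec nc; apply: bruhat_eq; last by lia.
  exact: lift_down.
have [du|nu] := boolP (right_descent u i); last first.
  have eu := ell_up _ _ nu.
  exists (u * gen i), (v * gen i); split.
  - by move/mulIg => eq; move: euv; rewrite eq; lia.
  - by split; [exact: le_gen|exact: lift_up|].
  - by split; [exact: lift_down|by []|lia].
  move=> c ca; have [dc|nc] := boolP (right_descent c i); last by right; apply: up_atom.
  case: ca => uc cv ec; left; apply/esym/bruhat_eq; last by lia.
  exact: lift_up.
have eu := ell_down _ _ du.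
have nu' : ~~ right_descent (u * gen i) i by rewrite right_descent_gen du.
have := lift_both _ _ i uv; rewrite du dv => /(_ erefl) le'.
have ltn' : (ell (v * gen i)%g < n)%N by lia.
have euv' : ell (v * gen i) = (ell (u * gen i)).+2 by lia.
have [a [b [ab aa ba abP]]] := IH _ _ ltn' le' euv'.
have down_atom c : atom u v c -> right_descent c i ->
    c * gen i = a \/ c * gen i = b.
  case=> uc cv ec dc; apply: abP; split.
  - by apply: lift_both => //; rewrite du dc.
  - by apply: lift_both => //; rewrite dv dc.
  by move: ec eu (ell_down _ _ dc); clear; lia.
have lift_atom c : atom (u * gen i) (v * gen i) c -> c <> u -> atom u v (c * gen i).
  case=> uc cv ec cu.
  have nc : ~~ right_descent c i.
    apply/negP => dc; apply/cu/esym/bruhat_eq; last by move: ec eu; clear; lia.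
    by rewrite -(mulgenK i u); apply: lift_up.
  split.
  - by rewrite -(mulgenK i u); apply: lift_both => //; rewrite (negbTE nu') (negbTE nc).
  - by rewrite -(mulgenK i v); apply: lift_both => //; rewrite (negbTE nv') (negbTE nc).
  by move: ec eu (ell_up _ _ nc); clear; lia.
have [uv'|nuv'] := EM (u <= v * gen i)%O.
  have [m [mu ma mP]] : exists m, [/\ m <> u, atom (u * gen i) (v * gen i) m &
      forall c, atom (u * gen i) (v * gen i) c -> c = u \/ c = m].
    have : atom (u * gen i) (v * gen i) u.
      by split; [exact: gen_le|exact: uv'|exact: eu].
    case/abP => ua.
      exists b; split; [by rewrite ua => /esym|exact: ba|].
      by move=> c /abP; rewrite ua.
    exists a; split; [by rewrite ua|exact: aa|].
    by move=> c /abP; rewrite ua => -[]; [right|left].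
  have at_m := lift_atom _ ma mu.
  exists (m * gen i), (v * gen i); split; [|exact: at_m| |].
  - by move/mulIg => eq; case: ma => _ _; rewrite eq; move: ev euv eu; clear; lia.
  - by split; [exact: uv'|exact: vsv|move: euv ev; clear; lia].
  move=> c ca; have [dc|nc] := boolP (right_descent c i); last by right; apply: up_atom.
  left; case: ca => uc cv ec.
  have : atom (u * gen i) (v * gen i) (c * gen i).
    split.
    - by apply: lift_both => //; rewrite du dc.
    - by apply: lift_both => //; rewrite dv dc.
    by move: ec eu (ell_down _ _ dc); clear; lia.
  case/mP => eq; last by rewrite -eq mulgenK.
  by move: (right_descent_gen c i); rewrite eq du dc.
have not_u c : atom (u * gen i) (v * gen i) c -> c <> u.
  by case=> _ cv _ eq; apply: nuv'; rewrite -eq.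
exists (a * gen i), (b * gen i); split.
- by move/mulIg.
- exact/lift_atom/not_u.
- exact/lift_atom/not_u.
move=> c ca; have [dc|nc] := boolP (right_descent c i); last first.
  by case: nuv'; rewrite -(up_atom c) //; case: ca.
by case: (down_atom c ca dc) => <-; rewrite mulgenK; [left|right].
Qed.

Definition at_most_two_atoms (u v : W) : Prop :=
  forall a b c, atom u v a -> atom u v b -> atom u v c -> [\/ a = b, b = c | a = c].

Lemma edge_acts (u v : W) : edge u v -> exists2 t, (exists p, acts_as t p) & v = u * t.
Proof. by case=> t /reflection_acts pt ->; exists t. Qed.

Lemma coatom_of_atom (u v a : W) : ell v = (ell u).+3 -> atom u v a ->
  exists c, [/\ (a <= c)%O, (c <= v)%O & ell c = (ell a).+1].
Proof.
move=> ev [ua av ea]; have ev' : ell v = (ell a).+2 by rewrite ea ev.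
by have [c [_ [_ hc _ _]]] := diamond _ _ av ev'; exists c.
Qed.

(** Every atom starts a saturated chain to v, hence an [up_chain] with the same
product, the reflection joining u to v. *)
Lemma edge_at_most_two (u v : W) : ell v = (ell u).+3 -> edge u v ->
  at_most_two_atoms u v.
Proof.
move=> ev /edge_acts [t [pt tP] vt].
have chain a : atom u v a -> exists r x y,
    up_chain pt r x y (alc u) /\ alc a = line_refl r (alc u).
  move=> at_a; have [c [ac cv ec]] := coatom_of_atom _ _ _ ev at_a.
  case: at_a => ua av ea.
  have ev1 : ell v = (ell c).+1 by rewrite ec ea.
  have [r [pr rP] ar] := edge_acts _ _ (cover_edge _ _ ua ea).
  have [x [px xP] cx] := edge_acts _ _ (cover_edge _ _ ac ec).
  have [y [py yP] vy] := edge_acts _ _ (cover_edge _ _ cv ev1).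
  have alc_a : alc a = line_refl pr (alc u) by rewrite ar; apply: acts_as_alc.
  have alc_c : alc c = line_refl px (alc a) by rewrite cx; apply: acts_as_alc.
  have alc_v : alc v = line_refl pt (alc u) by rewrite vt; apply: acts_as_alc.
  exists pr, px, py; split=> //; split; rewrite -?alc_a -?alc_c -?alc_v.
  - have eqt : t = r * x * y by apply: (@mulgI _ u); rewrite -vt !mulgA -ar -cx.
    by move=> S; rewrite -tP eqt !actM -rP -xP -yP.
  - by rewrite -!ell_dist0 ea; lia.
  - by rewrite -!ell_dist0 ec ea; lia.
  - by rewrite -!ell_dist0 ev; lia.
move=> a b c /chain [ra [xa [ya [ca alca]]]] /chain [rb [xb [yb [cb alcb]]]].
move=> /chain [rc [xc [yc [cc alcc]]]].
have := up_chain_unique2 _ _ _ _ _ _ _ _ _ _ _ (alc_valid u) ca cb cc.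
by case=> eq; [apply: Or31|apply: Or32|apply: Or33]; apply: alc_inj;
  rewrite ?alca ?alcb ?alcc eq.
Qed.

(** By the diamond property both coatoms above one atom lie above the other one.
The four reflections from the two atoms to the two coatoms, and the two from
the coatoms to v, are then in the pencil of the two reflections at u. *)
Lemma two_atoms_edge (u v : W) : (u <= v)%O -> ell v = (ell u).+3 ->
  at_most_two_atoms u v -> edge u v.
Proof.
move=> uv ev two.
have ltuv : (u < v)%O.
  by rewrite lt_neqAle uv andbT; apply/eqP => eq; move: ev; rewrite eq; clear; lia.
have [c0 [uc0 c0v ec0]] := coatom_ex _ _ ltuv.
have ec0' : ell c0 = (ell u).+2 by move: ec0; rewrite ev => -[->].
have [a1 [a2 [a12 ha1 ha2 _]]] := diamond _ _ uc0 ec0'.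
have atom_le c a : (c <= v)%O -> atom u c a -> atom u v a.
  by move=> cv [ua ac ea]; split=> //; apply: le_trans cv.
have at1 := atom_le _ _ c0v ha1; have at2 := atom_le _ _ c0v ha2.
have only a : atom u v a -> a = a1 \/ a = a2.
  by move=> ha; case: (two _ _ _ ha at1 at2) => // eq; [left|right].
case: (at1) => ua1 a1v ea1; case: (at2) => ua2 a2v ea2.
have ev1 : ell v = (ell a1).+2 by rewrite ev ea1.
have [c1 [c2 [c12 [ac1 c1v ec1] [ac2 c2v ec2] _]]] := diamond _ _ a1v ev1.
have above c : (a1 <= c)%O -> (c <= v)%O -> ell c = (ell a1).+1 -> (a2 <= c)%O.
  move=> ac cv ec.
  have ec' : ell c = (ell u).+2 by rewrite ec ea1.
  have [b1 [b2 [b12 hb1 hb2 _]]] := diamond _ _ (le_trans ua1 ac) ec'.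
  case: (only _ (atom_le _ _ cv hb1)) => eq1; last by rewrite -eq1; case: hb1.
  case: (only _ (atom_le _ _ cv hb2)) => eq2; last by rewrite -eq2; case: hb2.
  by case: b12; rewrite eq1.
have bc1 := above _ ac1 c1v ec1; have bc2 := above _ ac2 c2v ec2.
have [r1 [p1 r1P] a1r] := edge_acts _ _ (cover_edge _ _ ua1 ea1).
have [r2 [p2 r2P] a2r] := edge_acts _ _ (cover_edge _ _ ua2 ea2).
have [x1 [q1 x1P] c1x] := edge_acts _ _ (cover_edge _ _ ac1 ec1).
have [x2 [q2 x2P] c2x] := edge_acts _ _ (cover_edge _ _ ac2 ec2).
have [|z1 [s1 z1P] c1z] := edge_acts _ _ (cover_edge _ _ bc1 _).
  by rewrite ec1 ea1 ea2.
have [|z2 [s2 z2P] c2z] := edge_acts _ _ (cover_edge _ _ bc2 _).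
  by rewrite ec2 ea1 ea2.
have [|y1 [t1 y1P] vy1] := edge_acts _ _ (cover_edge _ _ c1v _); first by rewrite ev1 ec1.
have [|y2 [t2 y2P] vy2] := edge_acts _ _ (cover_edge _ _ c2v _); first by rewrite ev1 ec2.
have p12 : p1 <> p2.
  move=> eq; apply: a12; apply: alc_inj; rewrite a1r a2r.
  by rewrite (acts_as_alc _ _ _ r1P) (acts_as_alc _ _ _ r2P) eq.
have q12 : q1 <> q2.
  move=> eq; apply: c12; apply: alc_inj; rewrite c1x c2x.
  by rewrite (acts_as_alc _ _ _ x1P) (acts_as_alc _ _ _ x2P) eq.
have pq1 : pencil p1 p2 q1.
  apply: (@pencil_of_eq _ _ _ s1) => // S; rewrite -x1P -r1P -z1P -r2P -!actM.
  by congr act; apply: (@mulgI _ u); rewrite !mulgA -a1r -a2r -c1x -c1z.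
have pq2 : pencil p1 p2 q2.
  apply: (@pencil_of_eq _ _ _ s2) => // S; rewrite -x2P -r1P -z2P -r2P -!actM.
  by congr act; apply: (@mulgI _ u); rewrite !mulgA -a1r -a2r -c2x -c2z.
have qt1 : pencil q1 q2 t1.
  apply: (@pencil_of_eq _ _ _ t2) => // S; rewrite -y1P -x1P -y2P -x2P -!actM.
  by congr act; apply: (@mulgI _ a1); rewrite !mulgA -c1x -c2x -vy1 -vy2.
have pt1 := pencil_trans _ _ _ _ _ p12 q12 pq1 pq2 qt1.
have [t tP] := pencil_prod _ _ _ _ p12 pq1 pt1.
apply/edgeP; exists t; rewrite -tP.
rewrite vy1 (acts_as_alc _ _ _ y1P) c1x (acts_as_alc _ _ _ x1P) a1r.
by rewrite (acts_as_alc _ _ _ r1P).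
Qed.

Lemma ell_word (w : W) : exists2 u : word, size u = ell w & word_class u = w.
Proof. by rewrite /ell; case: ex_minnP => n /asboolP. Qed.

Lemma finite_ball n : finite_set [set w : W | (ell w <= n)%N].
Proof.
pose f (p : 'I_n.+1 * n.-tuple 'I_3) := word_class (take p.1 p.2).
apply: (@sub_finite_set _ _ (f @` [set: _])); last first.
  exact/finite_image/finite_finset.
move=> w /= wn; have [u su uw] := ell_word w.
have szt : size (u ++ nseq (n - size u) ord0) == n.
  by rewrite size_cat size_nseq subnKC // su.
exists (inord (size u), Tuple szt) => //.
by rewrite /f /= inordK ?take_size_cat // ltnS su.
Qed.

Lemma finite_interval (x y : W) : finite_set (bruhat_interval x y).
Proof.
apply: sub_finite_set (finite_ball (ell y)) => z [_ zy] /=.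
exact: bruhat_leE.
Qed.

(** * R-polynomials *)

Lemma edge_gen (u v : W) i : edge u v -> edge (u * gen i) (v * gen i).
Proof.
case=> t rt ->; exists (gen i * t * gen i); first exact: reflection_conj.
by rewrite !mulgA mulgenK.
Qed.

Lemma edge_gen_iff (u v : W) i : edge (u * gen i) (v * gen i) <-> edge u v.
Proof.
by split; [move/(edge_gen _ _ i); rewrite !mulgenK | exact: edge_gen].
Qed.

(** The induction behind the recursion for the R-polynomials: it moves down along
common descents until v has a descent that u does not have. *)
Lemma descent_ind (n : nat) (Q : W -> W -> Prop) :
  (forall u v i, (u <= v)%O -> ell v = (ell u + n.+1)%N ->
     right_descent v i -> ~~ right_descent u i -> Q u v) ->
  (forall u v i, (u <= v)%O -> ell v = (ell u + n.+1)%N ->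
     right_descent v i -> right_descent u i -> Q (u * gen i) (v * gen i) -> Q u v) ->
  forall u v, (u <= v)%O -> ell v = (ell u + n.+1)%N -> Q u v.
Proof.
move=> asc desc u v; have [k] := ubnP (ell v); elim: k u v => // k IH u v ltk uv ev.
have [i dv] : exists i, right_descent v i.
  by apply: exists_descent; rewrite ev addnS.
have [du|nu] := boolP (right_descent u i); last exact: asc ev dv nu.
apply: (desc _ _ i) => //; apply: IH.
- by move: ltk (ell_down _ _ dv); clear; lia.
- by apply: lift_both; rewrite ?du ?dv.
by move: ev (ell_down _ _ dv) (ell_down _ _ du); clear; lia.
Qed.

Section RPolynomials.
Local Open Scope ring_scope.
Variable R : W -> W -> {poly int}.
Hypothesis R_R : R_family R.

Lemma R_not_le u v : ~ (u <= v)%O -> R u v = 0.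
Proof. by case: R_R => R0 _ _ /negP; exact: R0. Qed.

Lemma R_refl u : R u u = 1.
Proof. by case: R_R. Qed.

Lemma R_descent u v i : right_descent v i -> right_descent u i ->
  R u v = R (u * gen i)%g (v * gen i)%g.
Proof. by case: R_R => _ _ rec dv du; rewrite (rec u v i dv) du. Qed.

Lemma R_ascent u v i : right_descent v i -> ~~ right_descent u i ->
  R u v = 'X * R (u * gen i)%g (v * gen i)%g + ('X - 1) * R u (v * gen i)%g.
Proof. by case: R_R => _ _ rec dv /negbTE du; rewrite (rec u v i dv) du. Qed.

Lemma R_len1 u v : (u <= v)%O -> ell v = (ell u + 1)%N -> R u v = 'X - 1.
Proof.
apply: (@descent_ind 0 (fun u v => R u v = _)) => {u v} u v i uv ev dv du;
  last by rewrite (R_descent _ _ _ dv du).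
have ltv := ell_down _ _ dv; have ltu := ell_up _ _ du.
have uvs := lift_down _ _ _ uv dv du.
have -> : u = (v * gen i)%g by apply: bruhat_eq uvs _; move: ev ltv; clear; lia.
rewrite (R_ascent _ _ _ dv) ?right_descent_gen ?dv // mulgenK R_refl mulr1.
rewrite R_not_le ?mulr0 ?add0r //.
by move/bruhat_leE; move: ltv; clear; lia.
Qed.

Lemma R_len2 u v : (u <= v)%O -> ell v = (ell u + 2)%N -> R u v = ('X - 1) ^+ 2.
Proof.
apply: (@descent_ind 1 (fun u v => R u v = _)) => {u v} u v i uv ev dv du;
  last by rewrite (R_descent _ _ _ dv du).
have ltv := ell_down _ _ dv; have ltu := ell_up _ _ du.
have uvs := lift_down _ _ _ uv dv du.
have nle : ~ ((u * gen i)%g <= (v * gen i)%g)%O.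
  move=> le'; suff uv' : u = v by move: ev; rewrite uv'; clear; lia.
  apply: (@mulIg _ (gen i)); apply: bruhat_eq le' _.
  by move: ev ltv ltu; clear; lia.
rewrite (R_ascent _ _ _ dv du) R_not_le // mulr0 add0r R_len1 //.
by move: ev ltv; clear; lia.
Qed.

Lemma R_len3 u v : (u <= v)%O -> ell v = (ell u + 3)%N ->
  R u v = ('X - 1) ^+ 3 + if `[< edge u v >] then 'X * ('X - 1) else 0.
Proof.
apply: (@descent_ind 2 (fun u v => R u v = _ + if `[< edge u v >] then _ else _))
  => {u v} u v i uv ev dv du.
  have ltv := ell_down _ _ dv; have ltu := ell_up _ _ du.
  have uvs := lift_down _ _ _ uv dv du.
  (* the additional term comes from u s <= v s, that is, from an edge between them,
   and conjugation turns this edge into one between u and v *)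
  rewrite (R_ascent _ _ _ dv du) (R_len2 u) //; last by move: ev ltv; clear; lia.
  have ev' : ell (v * gen i)%g = (ell (u * gen i)%g + 1)%N.
    by move: ev ltv ltu; clear; lia.
  rewrite -exprS addrC; congr (_ + _); case: asboolP => uv_edge.
    rewrite R_len1 //; apply: edge_le; last by rewrite ev'; clear; lia.
    exact: edge_gen.
  rewrite R_not_le ?mulr0 // => le'; apply: uv_edge; apply/(edge_gen_iff _ _ i).
  by apply: cover_edge; rewrite // ev' addn1.
move=> IH; rewrite (R_descent _ _ _ dv du) IH; congr (_ + _).
by rewrite (asbool_equiv_eq (edge_gen_iff u v i)).
Qed.

Lemma R_len4 u v : (u <= v)%O -> ell v = (ell u + 4)%N ->
  exists c : int, R u v = ('X - 1) ^+ 4 + c *: ('X * ('X - 1) ^+ 2).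
Proof.
apply: (@descent_ind 3 (fun u v => exists c : int, R u v = _ + c *: _)) 
  => {u v} u v i uv ev dv du; last first.
  by case=> c IH; exists c; rewrite (R_descent _ _ _ dv du).
have ltv := ell_down _ _ dv; have ltu := ell_up _ _ du.
have uvs := lift_down _ _ _ uv dv du.
rewrite (R_ascent _ _ _ dv du) (R_len3 u) //; last by move: ev ltv; clear; lia.
have [c1 ->] : exists c : int,
    'X * R (u * gen i)%g (v * gen i)%g = c *: ('X * ('X - 1) ^+ 2).
  have [le'|nle] := EM ((u * gen i)%g <= (v * gen i)%g)%O.
    by exists 1; rewrite scale1r R_len2 //; move: ev ltv ltu; clear; lia.
  by exists 0; rewrite scale0r R_not_le // mulr0.
case: asboolP => _; [exists (c1 + 1)|exists c1].
  by rewrite scalerDl scale1r mulrDr -exprS [('X - 1) * ('X * _)]mulrCA -expr2 addrCA.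
by rewrite addr0 -exprS addrC.
Qed.

End RPolynomials.

(** * Isomorphisms of intervals *)

Lemma iso_mono {x y x' y' : W} {phi : W -> W} : interval_iso x y x' y' phi ->
  forall u v, bruhat_interval x y u -> bruhat_interval x y v ->
  (phi u <= phi v)%O = (u <= v)%O.
Proof. by move=> [_ mono] u v hu hv; apply: mono; apply/mem_set. Qed.

Lemma iso_bounds {x y x' y' : W} {phi : W -> W} : (x <= y)%O -> (x' <= y')%O ->
  interval_iso x y x' y' phi -> phi x = x' /\ phi y = y'.
Proof.
move=> xy xy' iso; have mono := iso_mono iso; case: iso => -[into _ onto] _.
have ix : bruhat_interval x y x by split.
have iy : bruhat_interval x y y by split.
have [a ia ax] := onto x' (conj (lexx _) xy').
have [b ib bx] := onto y' (conj xy' (lexx _)).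
have [x1 _] := into _ ix; have [_ y1] := into _ iy.
split; apply/le_anti; apply/andP; split=> //.
- by rewrite -ax mono //; case: ia.
- by rewrite -bx mono //; case: ib.
Qed.

Lemma iso_sub {x y x' y' : W} {phi : W -> W} (a b : W) : interval_iso x y x' y' phi ->
  (x <= a)%O -> (a <= b)%O -> (b <= y)%O -> interval_iso a b (phi a) (phi b) phi.
Proof.
move=> iso xa ab by_; have mono := iso_mono iso; case: (iso) => -[into inj onto] mono'.
have sub z : bruhat_interval a b z -> bruhat_interval x y z.
  by case=> az zb; split; [apply: le_trans az|apply: le_trans by_].
have ia : bruhat_interval x y a by apply: sub; split.
have ib : bruhat_interval x y b by apply: sub; split.
split; last first.
  by move=> u v /set_mem hu /set_mem hv; apply: mono; apply: sub.
split.
- by move=> z hz; have := sub _ hz; case: hz => az zb hz; split; rewrite mono.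
- by move=> u v /set_mem hu /set_mem hv; apply: inj; apply/mem_set/sub.
move=> z' [az zb].
have [|z hz zz] := onto z'.
  have [? _] := into _ ia; have [_ ?] := into _ ib.
  by split; [apply: le_trans az|apply: le_trans zb _].
by exists z => //; split; [rewrite -(mono a z)|rewrite -(mono z b)] => //; rewrite zz.
Qed.

Lemma cover_rank (u v : W) : (u < v)%O ->
  (forall a, (u <= a)%O -> (a <= v)%O -> a = u \/ a = v) -> ell v = (ell u).+1.
Proof.
move=> uv cov; have [a [ua av ea]] := atom_ex _ _ uv.
case: (cov _ ua av) => eq; last by rewrite -eq.
by move: ea; rewrite eq; clear; lia.
Qed.

(** Intervals are graded by [ell], so that going up from z to y by covers can be
followed by phi: [cover_rank] recognizes covers from the order. *)
Lemma iso_rank {x y x' y' : W} {phi : W -> W} : interval_iso x y x' y' phi ->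
  forall z, bruhat_interval x y z -> (ell (phi z) + ell y = ell z + ell (phi y))%N.
Proof.
move=> iso z; have [n] := ubnP (ell y - ell z); elim: n z => // n IH z ltn iz.
have mono := iso_mono iso; case: (iso) => -[into inj onto] _.
have iy : bruhat_interval x y y by case: iz => xz zy; split=> //; apply: le_trans zy.
have [->|/eqP ne] := EM (z = y); first by rewrite addnC.
case: (iz) => xz zy.
have lt_zy : (z < y)%O by rewrite lt_neqAle ne zy.
have [a [za ay ea]] := atom_ex _ _ lt_zy.
have ia : bruhat_interval x y a by split=> //; apply: le_trans za.
have ltn' : (ell y - ell a < n)%N.
  by move: ltn ea (bruhat_leE _ _ ay); clear; lia.
have := IH _ ltn' ia.
suff -> : ell (phi a) = (ell (phi z)).+1 by move: ea; clear; lia.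
have za_ne : z <> a by move=> eq; move: ea; rewrite eq; clear; lia.
apply: cover_rank.
  rewrite lt_neqAle mono // za andbT; apply/eqP => eq; apply: za_ne.
  by apply: inj; rewrite ?inE.
move=> c' zc ca.
have [|c ic cc] := onto c'.
  have [? _] := into _ iz; have [_ ?] := into _ ia.
  by split; [apply: le_trans zc|apply: le_trans ca _].
rewrite -{c'}cc !mono // in zc ca *.
have [eq|lt] := bruhat_ell _ _ zc; first by left; rewrite eq.
right; congr phi; apply: bruhat_eq ca _; move: ea lt; clear; lia.
Qed.

Lemma iso_length {x y x' y' : W} {phi : W -> W} (n : nat) : (x <= y)%O -> (x' <= y')%O ->
  interval_iso x y x' y' phi -> ell y = (ell x + n)%N -> ell y' = (ell x' + n)%N.
Proof.
move=> xy xy' iso ey; have [px py] := iso_bounds xy xy' iso.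
have := iso_rank iso x (conj (lexx _) xy); rewrite px py ey; clear; lia.
Qed.

Lemma iso_atom {x y x' y' : W} {phi : W -> W} : (x <= y)%O -> (x' <= y')%O ->
  interval_iso x y x' y' phi -> forall a, bruhat_interval x y a ->
  (atom x' y' (phi a) <-> atom x y a).
Proof.
move=> xy xy' iso a ia; have [px py] := iso_bounds xy xy' iso.
have rx := iso_rank iso x (conj (lexx _) xy); have ra := iso_rank iso a ia.
rewrite px py in rx ra; have [into _ _] := iso.1; have [xa' ay'] := into _ ia.
by case: (ia) => xa ay; split=> -[_ _ e]; split=> //; move: rx ra e; clear; lia.
Qed.

Lemma iso_at_most_two {x y x' y' : W} {phi : W -> W} : (x <= y)%O -> (x' <= y')%O ->
  interval_iso x y x' y' phi -> (at_most_two_atoms x y <-> at_most_two_atoms x' y').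
Proof.
move=> xy xy' iso; have at_iso := iso_atom xy xy' iso.
case: (iso) => -[into inj onto] _.
have atom_in u v a : atom u v a -> bruhat_interval u v a by case.
split=> two a b c.
  move=> ha hb hc.
  have [a0 ia ea] := onto _ (atom_in _ _ _ ha).
  have [b0 ib eb] := onto _ (atom_in _ _ _ hb).
  have [c0 ic ec] := onto _ (atom_in _ _ _ hc).
  rewrite -{}ea -{}eb -{}ec in ha hb hc *.
  move/at_iso: ha => /(_ ia) ha; move/at_iso: hb => /(_ ib) hb.
  move/at_iso: hc => /(_ ic) hc.
  by case: (two _ _ _ ha hb hc) => ->; [apply: Or31|apply: Or32|apply: Or33].
move=> ha hb hc; have ia := atom_in _ _ _ ha.
have ib := atom_in _ _ _ hb; have ic := atom_in _ _ _ hc.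
have := two (phi a) (phi b) (phi c); rewrite !at_iso // => /(_ ha hb hc).
by case=> /inj; rewrite !inE => eq; [apply: Or31|apply: Or32|apply: Or33]; apply: eq.
Qed.

Lemma iso_edge {x y x' y' : W} {phi : W -> W} : (x <= y)%O -> (x' <= y')%O ->
  interval_iso x y x' y' phi -> ell y = (ell x + 3)%N -> (edge x y <-> edge x' y').
Proof.
move=> xy xy' iso ey; have ey' := iso_length 3 xy xy' iso ey.
rewrite addn3 in ey; rewrite addn3 in ey'.
have two := iso_at_most_two xy xy' iso.
split=> e.
  by apply: two_atoms_edge => //; apply/two; apply: edge_at_most_two.
by apply: two_atoms_edge => //; apply/two; apply: edge_at_most_two.
Qed.

Lemma R_iso (R : W -> W -> {poly int}) : R_family R ->
  forall (x y x' y' : W) (phi : W -> W) (n : nat), (x <= y)%O -> (x' <= y')%O ->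
  interval_iso x y x' y' phi -> (0 < n <= 3)%N -> ell y = (ell x + n)%N ->
  R x' y' = R x y.
Proof.
move=> RR x y x' y' phi n xy xy' iso n13 ey.
have ey' := iso_length n xy xy' iso ey.
case: n n13 ey ey' => [|[|[|[|n]]]] // _ ey ey'.
- by rewrite !(R_len1 _ RR).
- by rewrite !(R_len2 _ RR).
by rewrite !(R_len3 _ RR) // (asbool_equiv_eq (iso_edge xy xy' iso ey)).
Qed.

Local Close Scope group_scope.

(** * Kazhdan-Lusztig polynomials of isomorphic intervals *)

Lemma poly_reflectB d (p q : {poly int}) :
  (poly_reflect d (p - q) = poly_reflect d p - poly_reflect d q)%R.
Proof.
apply/polyP => i; rewrite coefB !coef_poly; case: ifP => _; last by rewrite subrr.
by rewrite coefB.
Qed.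

Section KL.
Local Open Scope ring_scope.

Lemma size_diff d (p q : {poly int}) : ((size p).-1.*2 < d)%N -> ((size q).-1.*2 < d)%N ->
  ((size (p - q)%R).-1.*2 < d)%N.
Proof.
move=> sp sq.
have sz : (size (p - q)%R <= maxn (size p) (size q))%N.
  by rewrite -(size_polyN q) size_polyD.
by move: sp sq sz; clear; lia.
Qed.

(** Reflection exchanges the coefficients of degree below d / 2 with those above,
and p only has the former. *)
Lemma reflect_eq0 d (p : {poly int}) : ((size p).-1.*2 < d)%N ->
  poly_reflect d p = p -> p = 0.
Proof.
move=> szp eqp; apply/polyP => i; rewrite coef0.
have [ge|lt] := leqP (size p) i; first by rewrite nth_default.
have ge : (size p <= d - i)%N by move: szp lt; clear; lia.
by rewrite -eqp coef_poly; case: ifP => // _; rewrite nth_default.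
Qed.

(** The coefficients of q and of q^3 in q (q - 1)^2 are both 1: the first gives
p1 = - c and the second p1 = c. *)
Lemma reflect4_eq0 (c : int) (p : {poly int}) : ((size p).-1.*2 < 4)%N ->
  poly_reflect 4 p = p + c *: ('X * ('X - 1) ^+ 2) -> p = 0.
Proof.
move=> deg eqp; have szp : (size p <= 2)%N by move: deg; clear; lia.
have quart : 'X * ('X - 1) ^+ 2 = 'X^3 - 'X^2 *+ 2 + 'X :> {poly int}.
  by rewrite sqrrB1 mulrDr mulr1 mulrBr mulrnAr -!exprS.
rewrite quart in eqp; have co i : (2 <= i)%N -> p`_i = 0.
  by move=> i2; rewrite nth_default // (leq_trans szp).
have E i := congr1 (fun q : {poly int} => q`_i) eqp.
have e0 := E 0%N; have e1 := E 1%N; have e3 := E 3%N.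
rewrite /poly_reflect !coef_poly !coefE /= in e0 e1 e3.
rewrite (co 4%N) // in e0; rewrite (co 3%N) // in e1; rewrite (co 3%N) // in e3.
rewrite !(mul0rn, subr0, addr0, add0r, mulr0, mulr1) in e0 e1 e3.
rewrite -[(4 - 3)%N]/1%N in e3.
rewrite -e3 -mulr2n in e1; apply/polyP => -[|[|i]]; rewrite coef0 //; last exact: co.
by apply/eqP; move/esym/eqP: e1; rewrite mulrn_eq0.
Qed.

Variables (P : W -> W -> {poly int}).
Hypotheses (RR : R_family R_poly) (PP : KL_family P).

(** The two end terms of the defining identity, where one of the factors is 1. *)
Lemma KL_reflect (x y : W) : (x < y)%O ->
  poly_reflect (ell y - ell x) (P x y) = P x y + (R_poly x y +
    \sum_(a \in (bruhat_interval x y `\ x) `\ y) R_poly x a * P a y).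
Proof.
move=> xy; case: PP => _ P1 _ -> ; last exact: ltW.
have fin := finite_interval x y.
rewrite (fsbigD1 x) //=; last by split=> //; exact: ltW.
rewrite (fsbigD1 y) /=.
- by rewrite (R_refl _ RR) mul1r P1 mulr1.
- exact: finite_setD.
- by split; [split=> //; exact: ltW | move=> eq; rewrite eq ltxx in xy].
Qed.

(** Terms strictly between the ends only involve shorter intervals, whose
R-polynomials and Kazhdan-Lusztig polynomials correspond under phi.  The two
remaining terms are separated by the degree bound. *)
Lemma KL_iso (n : nat) (x y x' y' : W) (phi : W -> W) : (n <= 4)%N ->
  (x <= y)%O -> (x' <= y')%O -> interval_iso x y x' y' phi ->
  ell y = (ell x + n)%N -> P x' y' = P x y.
Proof.
elim/ltn_ind: n x y x' y' phi => n IH x y x' y' phi n4 xy xy' iso ey.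
have [px py] := iso_bounds xy xy' iso.
have ey' := iso_length n xy xy' iso ey.
case: (PP) => _ P1 Pdeg _.
have [n0|npos] := posnP n.
  have <- : x = y by apply: bruhat_eq xy _; rewrite ey n0 addn0.
  have <- : x' = y' by apply: bruhat_eq xy' _; rewrite ey' n0 addn0.
  by rewrite !P1.
have lt_xy : (x < y)%O.
  rewrite lt_neqAle xy andbT; apply/eqP => eq.
  by move: npos ey; rewrite eq; clear; lia.
have lt_xy' : (x' < y')%O.
  rewrite lt_neqAle xy' andbT; apply/eqP => eq.
  by move: npos ey'; rewrite eq; clear; lia.
have szP := Pdeg _ _ lt_xy; have szP' := Pdeg _ _ lt_xy'.
have E := KL_reflect _ _ lt_xy; have E' := KL_reflect _ _ lt_xy'.
rewrite ey addKn in szP E; rewrite ey' addKn in szP' E'.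
have sumE : \sum_(a \in (bruhat_interval x' y' `\ x') `\ y') R_poly x' a * P a y' =
    \sum_(a \in (bruhat_interval x y `\ x) `\ y) R_poly x a * P a y.
  have bij : set_bij ((bruhat_interval x y `\ x) `\ y)
      ((bruhat_interval x' y' `\ x') `\ y') phi.
    case: (iso) => -[into inj onto] _.
    have ix : bruhat_interval x y x by split.
    have iy : bruhat_interval x y y by split.
    split.
    - move=> a [[ia ax] ay]; split; [split; first exact: into|].
        by rewrite -px => /inj; rewrite !inE => /(_ ia ix).
      by rewrite -py => /inj; rewrite !inE => /(_ ia iy).
    - by move=> a b /set_mem [[ia _] _] /set_mem [[ib _] _]; apply: inj; apply/mem_set.
    move=> a' [[ia' ax'] ay']; have [a ia aa'] := onto _ ia'.
    exists a => //; split; [split=> //|] => eq; [apply: ax'|apply: ay'];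
      by rewrite -aa' eq.
  rewrite (reindex_fsbig phi _ _ _ bij); apply: eq_fsbigr => a.
  move=> /set_mem [[[xa ay] ax_ne] ay_ne].
  have lt_xa : (ell x < ell a)%N.
    by case: (bruhat_ell _ _ xa) => // eq; case: ax_ne; rewrite eq.
  have lt_ay : (ell a < ell y)%N.
    by case: (bruhat_ell _ _ ay) => // eq; case: ay_ne.
  have isoxa := iso_sub x a iso (lexx _) xa ay.
  have isoay := iso_sub a y iso xa ay (lexx _).
  have mono := iso_mono iso.
  have xa' : (phi x <= phi a)%O by rewrite mono //; split.
  have ay' : (phi a <= phi y)%O by rewrite mono //; split.
  rewrite px in xa' isoxa; rewrite py in ay' isoay.
  rewrite (R_iso _ RR _ _ _ _ _ (ell a - ell x) xa xa' isoxa).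
  - rewrite (IH (ell y - ell a)%N _ _ _ _ _ _ _ ay ay' isoay) //.
    + by move: ey lt_xa lt_ay; clear; lia.
    + by move: n4 ey lt_xa lt_ay; clear; lia.
    + by move: lt_ay; clear; lia.
  - by move: n4 ey lt_xa lt_ay; clear; lia.
  by move: lt_xa; clear; lia.
apply/eqP; rewrite -subr_eq0; apply/eqP.
have ED : poly_reflect n (P x' y' - P x y) =
    (P x' y' - P x y) + (R_poly x' y' - R_poly x y).
  rewrite poly_reflectB E E' sumE opprD addrACA; congr (_ + _).
  by rewrite opprD addrACA subrr addr0.
have [n3|] := leqP n 3.
  apply: (@reflect_eq0 n); first exact: size_diff.
  by rewrite ED (R_iso _ RR _ _ _ _ _ n xy xy' iso) ?npos // subrr addr0.
move=> n_gt3; have n_eq : n = 4%N by move: n_gt3 n4; clear; lia.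
rewrite {n_gt3 n4}n_eq in ED szP szP' ey ey' *.
have [c Rc] := R_len4 _ RR _ _ xy ey; have [c' Rc'] := R_len4 _ RR _ _ xy' ey'.
apply: (@reflect4_eq0 (c' - c)); first exact: size_diff.
rewrite ED Rc Rc'; congr (_ + _); rewrite scalerBl.
by rewrite opprD addrACA subrr add0r.
Qed.

End KL.

Theorem lemma4p3 (x y x' y' : W) (phi : W -> W) (m : nat)
    (le_xy : (x <= y)%O) (le_xy' : (x' <= y')%O)
    (iso_phi : interval_iso x y x' y' phi)
    (m_ge1 : (1 <= m)%N) (m_le4 : (m <= 4)%N) :
  phi @` Zset m x y = Zset m x' y' /\ Zset m x y #= Zset m x' y'.
Proof.
suff imE : phi @` Zset m x y = Zset m x' y'.
  split=> //; rewrite -imE; apply: card_esym; apply: inj_card_eq.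
  move=> u v /set_mem [hu _ _] /set_mem [hv _ _]; case: (iso_phi) => -[_ inj _] _.
  by apply: inj; apply/mem_set.
(* without a family of Kazhdan-Lusztig polynomials KL_poly is the zero family, and
   without a family of R-polynomials no family P satisfies its identity for the
   interval reduced to the identity element *)
have [[P PP]|nP] := EM (exists P, KL_family P); last first.
  have KL0 u v : KL_poly u v = 0%R.
    by rewrite /KL_poly xgetPN // => P PP; apply: nP; exists P.
  have Z0 a b : Zset m a b = set0.
    rewrite -subset0 => z [_ _]; rewrite KL0 => /(congr1 (fun p : {poly int} => p`_1)%R).
    by rewrite !coefE.
  by rewrite !Z0 image_set0.
have KK : KL_family KL_poly by apply: xgetPex; exists P.
have [[R0 RR0]|nR] := EM (exists R, R_family R); last first.
  have R0 u v : R_poly u v = 0%R.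
    by rewrite /R_poly xgetPN // => R RR; apply: nR; exists R.
  case: PP => _ P1 _ /(_ 1%g 1%g (lexx _)) /(congr1 (fun p : {poly int} => p`_0)%R).
  rewrite subnn P1 fsbig1; last by move=> a _; rewrite R0 mul0r.
  by rewrite coef_poly coef1 coef0.
have RR : R_family R_poly by apply: xgetPex; exists R0.
have [px py] := iso_bounds le_xy le_xy' iso_phi.
have key z : bruhat_interval x y z -> Zset m x y z <-> Zset m x' y' (phi z).
  move=> iz; have rz := iso_rank iso_phi z iz; rewrite py in rz.
  have [into _ _] := iso_phi.1; have iz' := into _ iz.
  suff [rkE KLE] : (ell z + m = ell y <-> ell (phi z) + m = ell y')%N /\
      ((ell z + m)%N = ell y -> KL_poly (phi z) y' = KL_poly z y).
    split=> -[_ rk]; move: (rk) => /rkE rk'.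
      by rewrite -KLE.
    by rewrite KLE.
  split; first by split; move: rz; clear; lia.
  move=> rk; case: (iz) => xz zy; case: iz' => xz' zy'.
  apply: (KL_iso _ RR KK m z y (phi z) y' phi) => //.
  by have := iso_sub z y iso_phi xz zy (lexx y); rewrite py.
apply/seteqP; split=> [_ [z zZ <-]|z' zZ'].
  by apply/key => //; case: zZ.
have [_ _ onto] := iso_phi.1.
have [z iz zz'] := onto z' (let: And3 i _ _ := zZ' in i).
by exists z => //; apply/key => //; rewrite zz'.
Qed.
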